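(* Given any sequence of positive real numbers $\{a_n\}_{n\geq 1}$, there is a continuous function $f:\mathbb{R}\to\mathbb{C}$ such that the Fourier transform $\hat{f}(s)=\int_{-\infty}^{\infty}e^{isx}f(x)\,dx$ exists (as a possibly conditionally convergent integral) for each $s\in\mathbb{R}$, and $\hat{f}(n)\geq a_n$ for all integers $n\geq 1$.
   Context: The Fourier transform is $\hat{f}(s)=\int_{-\infty}^{\infty}e^{isx}f(x)\,dx$ for $s\in\mathbb{R}$. The integral is allowed to converge conditionally: it is understood as an improper Riemann integral (or equivalently, for continuous integrands, as a Henstock integral), so ''$\hat{f}(s)$ exists'' means that both $\lim_{B\to\infty}\int_0^{B}e^{isx}f(x)\,dx$ and $\lim_{A\to\infty}\int_{-A}^{0}e^{isx}f(x)\,dx$ exist as finite complex numbers, and $\hat f(s)$ is their sum. It is not required that $f\in L^1(\mathbb{R})$. The inequality $\hat{f}(n)\geq a_n$ means that $\hat{f}(n)$ is a real number that is at least $a_n$. *)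

(* Defs.v *)
From Stdlib Require Import Reals.
From Coquelicot Require Import Coquelicot.
Open Scope R_scope.

(* Euler's formula; Coquelicot's [C] is [R * R] and has no complex exponential. *)
Definition expi (t : R) : C := (cos t, sin t).

(* The two half-lines converge independently of each other, so this is not a
   principal value; each half is a possibly conditionally convergent improper
   Riemann integral. *)
Definition is_fourier (f : R -> C) (s : R) (l : C) : Prop :=
  exists lneg lpos : C,
    is_RInt_gen (V := C_R_NormedModule)
      (fun x => Cmult (expi (s * x)) (f x)) (Rbar_locally m_infty) (at_point 0) lneg /\
    is_RInt_gen (V := C_R_NormedModule)
      (fun x => Cmult (expi (s * x)) (f x)) (at_point 0) (Rbar_locally p_infty) lpos /\
    l = Cplus lneg lpos.

Definition ex_fourier (f : R -> C) (s : R) : Prop :=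
  exists l : C, is_fourier f s l.

(* Main.v *)
Require Import Defs.
From Stdlib Require Import Reals ZArith Lra Lia.
From Coquelicot Require Import Coquelicot.
Open Scope R_scope.

(** The function is f = - i g, where g vanishes on the negative half-line and
    the positive half-line is cut into blocks [t k, t (S k)], with t 0 = 0 and
    every t k a multiple of 2 PI; on the k-th block g x = 2^-k sin (k x).
    Every sin (k x) vanishes at the ends of the blocks, so g is continuous.

    Since exp (i s x) (- i) = sin (s x) - i cos (s x), the transform has real
    part the integral of sin (s x) g and imaginary part minus that of
    cos (s x) g. Both are treated at once by integrating cos (s x - th) g
    with th = PI / 2 or th = 0.

    Convergence at every s: once k >= |s| + 1, an explicit antiderivative shows
    that integrals of cos (s x - th) sin (k x) are at most 2 in
    absolute value over any interval, however long. Hence any piece of the integral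
    inside block k is at most 2 * 2^-k, and the improper integral converges
    ([fourier_component_converges]). The lengths of the blocks remain free.

    Value at an integer m >= 1: each block consists of full periods of all the
    integer modes, so by orthogonality only block m contributes to the
    transform ([fourier_component_at_integer]). Its contribution is
    2^-m (t (S m) - t m) / 2, a real number, and choosing block m long enough
    makes this at least a m. *)

(** * Gluing functions along consecutive intervals *)

(** Clamping the argument of [h k] to its block extends [h k], which is zero at
    both ends of the block, by zero; the first n blocks are then just summed. *)
Fixpoint glued (t : nat -> R) (h : nat -> R -> R) (n : nat) (x : R) : R :=
  match n with
  | O => 0
  | S k => glued t h k x + h k (Rmax (t k) (Rmin x (t (S k))))
  end.

Lemma mono_le (t : nat -> R) (n m : nat) :
  (forall k, t k <= t (S k)) -> (n <= m)%nat -> t n <= t m.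
Proof.
  intros Ht H; induction H as [|m _ IH]; [lra|].
  specialize (Ht m); lra.
Qed.

Lemma glued_right (t : nat -> R) (h : nat -> R -> R) (n : nat) (x : R) :
  (forall k, t k <= t (S k)) -> (forall k, h k (t (S k)) = 0) ->
  t n <= x -> glued t h n x = 0.
Proof.
  intros Ht Hr; induction n as [|n IH]; intros Hx; simpl; [reflexivity|].
  pose proof (Ht n).
  rewrite IH, Rmin_right, Rmax_right, Hr by lra; lra.
Qed.

Lemma glued_stable (t : nat -> R) (h : nat -> R -> R) (n m : nat) (x : R) :
  (forall k, t k <= t (S k)) -> (forall k, h k (t k) = 0) ->
  x <= t n -> (n <= m)%nat -> glued t h m x = glued t h n x.
Proof.
  intros Ht Hl Hx H; induction H as [|m H IH]; [reflexivity|]; simpl.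
  pose proof (mono_le t n m Ht H); pose proof (Ht m).
  rewrite IH, Rmin_left, Rmax_left, Hl by lra; lra.
Qed.

(** Clamping is 1-Lipschitz. *)
Lemma continuous_clamp (a b x : R) :
  continuous (fun y => Rmax a (Rmin y b)) x.
Proof.
  intros P [e He]; exists e; intros y Hy; apply He.
  change (Rabs (y - x) < e) in Hy.
  change (Rabs (Rmax a (Rmin y b) - Rmax a (Rmin x b)) < e).
  refine (Rle_lt_trans _ _ _ _ Hy).
  unfold Rmax, Rmin; repeat destruct (Rle_dec _ _);
    unfold Rabs; repeat destruct (Rcase_abs _); lra.
Qed.

Lemma glued_continuous (t : nat -> R) (h : nat -> R -> R) (n : nat) (x : R) :
  (forall k y, continuous (h k) y) -> continuous (glued t h n) x.
Proof.
  intros Hc; induction n as [|n IH].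
  - apply continuous_const.
  - apply (continuous_plus (glued t h n)
      (fun x => h n (Rmax (t n) (Rmin x (t (S n)))))); [exact IH|].
    apply (continuous_comp (fun x => Rmax (t n) (Rmin x (t (S n)))) (h n));
      [apply continuous_clamp | apply Hc].
Qed.

Lemma le_INR_up (x : R) : x <= INR (Z.to_nat (up x)).
Proof.
  destruct (archimed x) as [H _].
  destruct (Z_le_gt_dec 0 (up x)) as [Hz|Hz].
  - rewrite INR_IZR_INZ, Z2Nat.id by exact Hz; lra.
  - assert (IZR (up x) <= 0) by (apply IZR_le; lia).
    pose proof (pos_INR (Z.to_nat (up x))); lra.
Qed.

(** The infinite sum of the clamped blocks is locally finite: since k <= t k, the
    first [up x] blocks already decide the value at x, and the first [up (x + 1)]
    of them decide the values throughout a neighbourhood of x. *)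
Lemma glue_blocks (t : nat -> R) (h : nat -> R -> R) :
  (forall k, t k <= t (S k)) -> (forall k, INR k <= t k) ->
  (forall k x, continuous (h k) x) ->
  (forall k, h k (t k) = 0) -> (forall k, h k (t (S k)) = 0) ->
  exists g : R -> R,
    (forall x, continuous g x) /\
    (forall x, x <= t O -> g x = 0) /\
    (forall k x, t k <= x <= t (S k) -> g x = h k x).
Proof.
  intros Ht Hu Hc Hl Hr.
  set (N := fun x : R => Z.to_nat (up x)).
  assert (HN : forall x, x <= t (N x)).
  { intros x; apply Rle_trans with (2 := Hu _), le_INR_up. }
  exists (fun x => glued t h (N x) x).
  assert (Hg : forall n x, x <= t n -> glued t h (N x) x = glued t h n x).
  { intros n x Hx.
    destruct (Nat.le_ge_cases (N x) n) as [H|H].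
    - symmetry; apply glued_stable; auto.
    - apply glued_stable; auto. }
  split; [|split].
  - intros x.
    pose proof (HN (x + 1)) as H1.
    apply (continuous_ext_loc _ (glued t h (N (x + 1)))).
    + exists (mkposreal 1 Rlt_0_1); intros y Hy; symmetry; apply Hg.
      change (Rabs (y - x) < 1) in Hy; apply Rabs_def2 in Hy; lra.
    + apply glued_continuous, Hc.
  - intros x Hx; exact (Hg O x Hx).
  - intros k x Hx; rewrite (Hg (S k)) by lra; simpl.
    rewrite glued_right, Rmin_left, Rmax_right by (auto; lra); lra.
Qed.

(** * Convergence of improper integrals by blocks *)

Lemma block_of (t : nat -> R) (N : nat) (X : R) :
  (forall k, t k <= t (S k)) -> (forall k, INR k <= t k) -> t N <= X ->
  exists n, (N <= n)%nat /\ t n <= X <= t (S n).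
Proof.
  intros Ht Hu HX.
  assert (H : forall m, X <= t (N + m)%nat ->
    exists n, (N <= n)%nat /\ t n <= X <= t (S n)).
  { induction m as [|m IH]; intros Hm.
    - rewrite Nat.add_0_r in Hm; exists N; pose proof (Ht N); split; [lia|lra].
    - destruct (Rle_dec X (t (N + m)%nat)) as [H|H]; [exact (IH H)|].
      exists (N + m)%nat; split; [lia|].
      rewrite Nat.add_succ_r in Hm; lra. }
  apply (H (Z.to_nat (up X))).
  apply Rle_trans with (1 := le_INR_up X).
  apply Rle_trans with (1 := Hu _), mono_le; [exact Ht|lia].
Qed.

Lemma ex_RInt_everywhere_continuous (h : R -> R) (u v : R) :
  (forall x, continuous h x) -> ex_RInt h u v.
Proof. intros Hc; apply (ex_RInt_continuous h); intros x _; apply Hc. Qed.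

(** The integrals over full blocks form an absolutely convergent series, which
    gives the limit along the block ends; at a point inside a block the
    integral differs from its value at the left end by at most b n, which tends
    to zero. The bound need only hold from some block on, because in the
    application the first blocks may resonate with the frequency s. *)
Lemma improper_integral_by_blocks (h : R -> R) (t b : nat -> R) (K : nat) :
  (forall x, continuous h x) ->
  t O = 0 -> (forall k, t k <= t (S k)) -> (forall k, INR k <= t k) ->
  ex_series b ->
  (forall n X, (K <= n)%nat -> t n <= X <= t (S n) ->
     Rabs (RInt h (t n) X) <= b n) ->
  exists l : R,
    is_lim_seq (fun n => RInt h 0 (t n)) l /\
    is_lim (fun X => RInt h 0 X) p_infty l.
Proof.
  intros Hc H0 Ht Hu Hb Hblk.
  set (d := fun n => RInt h (t n) (t (S n))).
  assert (Hd : ex_series d).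
  { apply (ex_series_incr_n d K).
    apply (ex_series_le (fun k => d (K + k)%nat) (fun k => b (K + k)%nat)).
    - intros n; apply Hblk; [lia|split; [apply Ht|lra]].
    - apply (ex_series_incr_n b K), Hb. }
  destruct Hd as [l Hl]; exists l.
  assert (Hsum : forall n, sum_n d n = RInt h 0 (t (S n))).
  { induction n as [|n IH].
    - rewrite sum_O; unfold d; now rewrite H0.
    - rewrite sum_Sn, IH; unfold d.
      apply (RInt_Chasles h); apply ex_RInt_everywhere_continuous, Hc. }
  assert (Hseq : is_lim_seq (fun n => RInt h 0 (t n)) l).
  { apply is_lim_seq_incr_1.
    apply (is_lim_seq_ext (sum_n d)); [exact Hsum|exact Hl]. }
  split; [exact Hseq|].
  apply is_lim_spec; intros eps.
  assert (He : 0 < eps / 2) by (pose proof (cond_pos eps); lra).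
  apply is_lim_seq_spec in Hseq.
  destruct (Hseq (mkposreal _ He)) as [N1 HN1].
  pose proof (ex_series_lim_0 b Hb) as Hb0.
  apply is_lim_seq_spec in Hb0.
  destruct (Hb0 (mkposreal _ He)) as [N2 HN2].
  simpl in HN1, HN2.
  exists (t (K + N1 + N2)%nat); intros X HX.
  destruct (block_of t (K + N1 + N2) X Ht Hu (Rlt_le _ _ HX)) as [n [Hn HXn]].
  specialize (HN1 n ltac:(lia)); specialize (HN2 n ltac:(lia)).
  specialize (Hblk n X ltac:(lia) HXn).
  rewrite <- (RInt_Chasles h 0 (t n) X) by (apply ex_RInt_everywhere_continuous, Hc).
  change (Rabs (RInt h 0 (t n) + RInt h (t n) X - l) < eps).
  replace (RInt h 0 (t n) + RInt h (t n) X - l)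
    with (RInt h 0 (t n) - l + RInt h (t n) X) by ring.
  rewrite Rminus_0_r in HN2.
  pose proof (Rle_abs (b n)).
  eapply Rle_lt_trans; [apply Rabs_triang|]; lra.
Qed.

(** * Integrals of a single mode *)

(** Antiderivative of cos (s x - th) sin (n x) for n different from s and - s. *)
Definition mode_prim (s th n x : R) : R :=
  - / 2 * (cos ((n + s) * x - th) / (n + s) + cos ((n - s) * x + th) / (n - s)).

Lemma mode_product_continuous (s th n x : R) :
  continuous (fun x => cos (s * x - th) * sin (n * x)) x.
Proof.
  apply (ex_derive_continuous (fun x => cos (s * x - th) * sin (n * x))).
  now auto_derive.
Qed.

Lemma product_to_sum (s th n x : R) :
  cos (s * x - th) * sin (n * x)
  = / 2 * (sin ((n + s) * x - th) + sin ((n - s) * x + th)).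
Proof.
  replace ((n + s) * x - th) with (n * x + (s * x - th)) by ring.
  replace ((n - s) * x + th) with (n * x - (s * x - th)) by ring.
  rewrite sin_plus, (sin_minus (n * x)); field.
Qed.

Lemma mode_integral (s th n u v : R) :
  n + s <> 0 -> n - s <> 0 ->
  is_RInt (fun x => cos (s * x - th) * sin (n * x)) u v
    (mode_prim s th n v - mode_prim s th n u).
Proof.
  intros H1 H2.
  apply (is_RInt_derive (mode_prim s th n)); intros x _; [|apply mode_product_continuous].
  unfold mode_prim; auto_derive; [tauto|].
  rewrite product_to_sum; unfold Rminus in *; field; tauto.
Qed.

(** The bound is uniform in x: this is what allows arbitrarily long blocks. *)
Lemma mode_prim_bound (s th n x : R) :
  1 <= n + s -> 1 <= n - s -> Rabs (mode_prim s th n x) <= 1.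
Proof.
  intros H1 H2; unfold mode_prim.
  assert (H : forall c y, 1 <= y -> Rabs (cos c / y) <= 1).
  { intros c y Hy; unfold Rdiv; rewrite Rabs_mult, <- (Rmult_1_r 1).
    apply Rmult_le_compat; try apply Rabs_pos.
    - apply Rabs_le, COS_bound.
    - rewrite Rabs_pos_eq by (left; apply Rinv_0_lt_compat; lra).
      rewrite <- Rinv_1; apply Rinv_le_contravar; lra. }
  pose proof (H ((n + s) * x - th) _ H1) as A1.
  pose proof (H ((n - s) * x + th) _ H2) as A2.
  apply Rabs_le_between in A1; apply Rabs_le_between in A2.
  apply Rabs_le; lra.
Qed.

Lemma cos_period_opp (y : R) (j : nat) : cos (y - 2 * INR j * PI) = cos y.
Proof. rewrite <- (cos_period _ j); f_equal; ring. Qed.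

(** At multiples of 2 PI both cosines are evaluated a whole number of periods away
    from their value at 0, because n + m and n - m are integers. *)
Lemma mode_prim_periods (m n k : nat) (th : R) :
  mode_prim (INR m) th (INR n) (2 * INR k * PI) = mode_prim (INR m) th (INR n) 0.
Proof.
  unfold mode_prim; do 2 f_equal; f_equal.
  - replace ((INR n + INR m) * (2 * INR k * PI) - th)
      with ((INR n + INR m) * 0 - th + 2 * INR ((n + m) * k) * PI)
      by (rewrite mult_INR, plus_INR; ring).
    apply cos_period.
  - destruct (Nat.le_ge_cases m n) as [H|H].
    + replace ((INR n - INR m) * (2 * INR k * PI) + th)
        with ((INR n - INR m) * 0 + th + 2 * INR ((n - m) * k) * PI)
        by (rewrite mult_INR, minus_INR by exact H; ring).
      apply cos_period.
    + replace ((INR n - INR m) * (2 * INR k * PI) + th)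
        with ((INR n - INR m) * 0 + th - 2 * INR ((m - n) * k) * PI)
        by (rewrite mult_INR, minus_INR by exact H; ring).
      apply cos_period_opp.
Qed.

(** The resonant case: the product is the constant sin th / 2 plus an
    oscillation of frequency 2 m, which integrates to zero over full periods. *)
Lemma mode_integral_diag (m j k : nat) (th : R) :
  (1 <= m)%nat ->
  is_RInt (fun x => cos (INR m * x - th) * sin (INR m * x))
    (2 * INR j * PI) (2 * INR k * PI)
    (sin th / 2 * (2 * INR k * PI - 2 * INR j * PI)).
Proof.
  intros Hm.
  assert (Hm1 : 1 <= INR m) by (change 1 with (INR 1); apply le_INR, Hm).
  set (Q := fun x => / 2 * (x * sin th - cos (2 * INR m * x - th) / (2 * INR m))).
  replace (sin th / 2 * (2 * INR k * PI - 2 * INR j * PI))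
    with (Q (2 * INR k * PI) - Q (2 * INR j * PI)).
  - apply (is_RInt_derive Q); intros x _; [|apply mode_product_continuous].
    unfold Q; auto_derive; [trivial|].
    rewrite product_to_sum.
    replace ((INR m + INR m) * x - th) with (2 * INR m * x - th) by ring.
    replace ((INR m - INR m) * x + th) with th by ring.
    unfold Rminus; field; lra.
  - assert (Hp : forall i, cos (2 * INR m * (2 * INR i * PI) - th) = cos (- th)).
    { intros i; rewrite <- (cos_period (- th) (2 * m * i)), !mult_INR.
      f_equal; simpl; ring. }
    unfold Q; rewrite !Hp; field; lra.
Qed.

(** * The Fourier integral of the glued function *)

Section Blocks.

Variables (M : nat -> nat) (g : R -> R).
Let t (k : nat) : R := 2 * INR (M k) * PI.
Hypothesis M0 : M O = O.
Hypothesis M_incr : forall k, (M k < M (S k))%nat.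
Hypothesis g_cont : forall x, continuous g x.
Hypothesis g_block :
  forall k x, t k <= x <= t (S k) -> g x = (/ 2) ^ k * sin (INR k * x).

Lemma block_ends_mono (k : nat) : t k <= t (S k).
Proof.
  unfold t; pose proof PI_RGT_0.
  pose proof (le_INR _ _ (Nat.lt_le_incl _ _ (M_incr k))); nra.
Qed.

Lemma block_ends_unbounded (k : nat) : INR k <= t k.
Proof.
  assert (H : (k <= M k)%nat).
  { induction k as [|k IH]; [lia|]; specialize (M_incr k); lia. }
  apply le_INR in H; unfold t.
  pose proof PI2_1; pose proof (pos_INR k); nra.
Qed.

Lemma block_RInt (s th : R) (n : nat) (u v w : R) :
  t n <= u <= v -> v <= t (S n) ->
  is_RInt (fun x => cos (s * x - th) * sin (INR n * x)) u v w ->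
  is_RInt (fun x => cos (s * x - th) * g x) u v ((/ 2) ^ n * w).
Proof.
  intros Hu Hv Hw.
  apply (is_RInt_ext
    (fun x => scal ((/ 2) ^ n) (cos (s * x - th) * sin (INR n * x)))).
  - intros x; rewrite Rmin_left, Rmax_right by lra; intros Hx.
    rewrite g_block with (k := n) by lra.
    unfold scal; simpl; unfold mult; simpl; ring.
  - apply (is_RInt_scal (fun x => cos (s * x - th) * sin (INR n * x))), Hw.
Qed.

Lemma integrand_cont (s th x : R) : continuous (fun x => cos (s * x - th) * g x) x.
Proof.
  apply (continuous_mult (fun x => cos (s * x - th)) g); [|apply g_cont].
  apply (ex_derive_continuous (fun x => cos (s * x - th))); now auto_derive.
Qed.

(** Only finitely many blocks have frequency below |s| + 1; on the others, the
    boundedness of the antiderivative and the factor 2^-n give a geometric bound. *)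
Lemma fourier_component_converges (s th : R) :
  exists l : R,
    is_lim_seq (fun n => RInt (fun x => cos (s * x - th) * g x) 0 (t n)) l /\
    is_lim (fun X => RInt (fun x => cos (s * x - th) * g x) 0 X) p_infty l.
Proof.
  set (K := Z.to_nat (up (Rabs s + 1))).
  apply improper_integral_by_blocks with (b := fun n => 2 * (/ 2) ^ n) (K := K).
  - apply integrand_cont.
  - unfold t; rewrite M0; simpl; ring.
  - apply block_ends_mono.
  - apply block_ends_unbounded.
  - apply (ex_series_scal 2 (fun n => (/ 2) ^ n)), ex_series_geom.
    rewrite Rabs_pos_eq; lra.
  - intros n X Hn HX.
    assert (Hs : Rabs s + 1 <= INR n).
    { apply Rle_trans with (1 := le_INR_up _), le_INR, Hn. }
    pose proof (Rle_abs s); pose proof (Rle_abs (- s)); rewrite Rabs_Ropp in *.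
    rewrite (is_RInt_unique _ _ _ _
      (block_RInt s th n _ _ _ (conj (Rle_refl _) (proj1 HX)) (proj2 HX)
        (mode_integral s th (INR n) (t n) X ltac:(lra) ltac:(lra)))).
    assert (Hp : 0 < (/ 2) ^ n) by (apply pow_lt; lra).
    rewrite Rabs_mult, Rabs_pos_eq by lra.
    pose proof (mode_prim_bound s th (INR n) X ltac:(lra) ltac:(lra)) as B1.
    pose proof (mode_prim_bound s th (INR n) (t n) ltac:(lra) ltac:(lra)) as B2.
    apply Rabs_le_between in B1; apply Rabs_le_between in B2.
    rewrite Rmult_comm; apply Rmult_le_compat_r; [lra|].
    apply Rabs_le; lra.
Qed.

(** Orthogonality of the integer modes over full periods, summed over the first
    n blocks. Block 0 carries the zero function and fits the nonresonant case. *)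
Lemma integer_partial_integral (m n : nat) (th : R) :
  (1 <= m)%nat ->
  is_RInt (fun x => cos (INR m * x - th) * g x) 0 (t n)
    (if (n <=? m)%nat then 0 else (/ 2) ^ m * (sin th / 2 * (t (S m) - t m))).
Proof.
  intros Hm; induction n as [|n IH].
  - replace (t 0) with 0 by (unfold t; rewrite M0; simpl; ring).
    apply (is_RInt_point (fun x => cos (INR m * x - th) * g x)).
  - pose proof (block_ends_mono n) as Hn.
    destruct (Nat.eq_dec n m) as [->|Hne].
    + rewrite Nat.leb_refl in IH.
      destruct (Nat.leb_spec (S m) m); [lia|].
      rewrite <- (Rplus_0_l (_ * _)).
      apply (is_RInt_Chasles _ _ _ _ _ _ IH).
      apply block_RInt; [lra|lra|apply mode_integral_diag, Hm].
    + assert (Hz : is_RInt (fun x => cos (INR m * x - th) * g x)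
                     (t n) (t (S n)) 0).
      { rewrite <- (Rmult_0_r ((/ 2) ^ n)).
        apply block_RInt; [lra|lra|].
        replace 0 with (mode_prim (INR m) th (INR n) (t (S n))
                        - mode_prim (INR m) th (INR n) (t n))
          by (unfold t; rewrite !mode_prim_periods; ring).
        apply mode_integral.
        - pose proof (pos_INR n); pose proof (lt_0_INR m Hm); lra.
        - intros E; apply Hne, INR_eq; lra. }
      pose proof (is_RInt_Chasles _ _ _ _ _ _ IH Hz) as H.
      unfold plus in H; simpl in H; rewrite Rplus_0_r in H.
      destruct (Nat.leb_spec n m); destruct (Nat.leb_spec (S n) m);
        [exact H|lia|lia|exact H].
Qed.

(** Along the block ends the integral is eventually constant, so the limit that
    is known to exist is this constant. *)
Lemma fourier_component_at_integer (m : nat) (th : R) :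
  (1 <= m)%nat ->
  is_lim (fun X => RInt (fun x => cos (INR m * x - th) * g x) 0 X) p_infty
    ((/ 2) ^ m * (sin th / 2 * (t (S m) - t m))).
Proof.
  intros Hm; destruct (fourier_component_converges (INR m) th) as [l [Hseq Hlim]].
  replace (_ * _) with l; [exact Hlim|].
  apply is_lim_seq_unique in Hseq.
  assert (H : is_lim_seq (fun n => RInt (fun x => cos (INR m * x - th) * g x) 0 (t n))
                ((/ 2) ^ m * (sin th / 2 * (t (S m) - t m)))).
  { apply is_lim_seq_ext_loc with (2 := is_lim_seq_const _).
    exists (S m); intros n Hn; symmetry.
    rewrite (is_RInt_unique _ _ _ _ (integer_partial_integral m n th Hm)).
    destruct (Nat.leb_spec n m); [lia|reflexivity]. }
  apply is_lim_seq_unique in H; congruence.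
Qed.

End Blocks.

(** * Assembling the complex transform *)

Lemma is_RInt_gen_complex (h1 h2 : R -> R) (l1 l2 : R) :
  (forall x, continuous h1 x) -> (forall x, continuous h2 x) ->
  is_lim (fun X => RInt h1 0 X) p_infty l1 ->
  is_lim (fun X => RInt h2 0 X) p_infty l2 ->
  is_RInt_gen (V := C_R_NormedModule) (fun x => (h1 x, h2 x))
    (at_point 0) (Rbar_locally p_infty) (l1, l2).
Proof.
  intros H1 H2 L1 L2 P [e He].
  apply is_lim_spec in L1; apply is_lim_spec in L2.
  apply (Filter_prod _ _ _ (fun x => x = 0)
    (fun X => Rabs (RInt h1 0 X - l1) < e /\ Rabs (RInt h2 0 X - l2) < e)).
  - reflexivity.
  - exact (filter_and _ _ (L1 e) (L2 e)).
  - intros x X -> [B1 B2]; exists (RInt h1 0 X, RInt h2 0 X); split.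
    + apply (is_RInt_fct_extend_pair (fun x => (h1 x, h2 x)));
        apply (RInt_correct (V := R_CompleteNormedModule)), ex_RInt_everywhere_continuous; assumption.
    + apply He; split; assumption.
Qed.

(** Multiplying exp (i s x) by - i g x yields sin (s x) g x - i cos (s x) g x, and
    the sine is the cosine shifted by PI / 2. The negative half-line contributes
    nothing. *)
Lemma is_fourier_of_components (g : R -> R) (s c d : R) :
  (forall x, continuous g x) -> (forall x, x <= 0 -> g x = 0) ->
  is_lim (fun X => RInt (fun x => cos (s * x - 0) * g x) 0 X) p_infty c ->
  is_lim (fun X => RInt (fun x => cos (s * x - PI / 2) * g x) 0 X) p_infty d ->
  is_fourier (fun x => (0, - g x)) s (d, - c).
Proof.
  intros Hg Hneg Hc Hd; exists (0, 0), (d, - c); split; [|split].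
  - intros P HP.
    apply (Filter_prod _ _ _ (fun X => X < 0) (fun x => x = 0)).
    + exists 0; auto.
    + reflexivity.
    + intros X y HX ->; exists (0, 0); split; [|exact (locally_singleton _ _ HP)].
      apply (is_RInt_ext (V := C_R_NormedModule) (fun _ => (0, 0))).
      * simpl; intros x; rewrite Rmin_left, Rmax_right by lra; intros Hx.
        unfold Cmult, expi; simpl; rewrite Hneg by lra; f_equal; ring.
      * assert (E0 : scal (V := C_R_NormedModule) (0 - X) (0, 0) = (0, 0))
          by (apply injective_projections; apply Rmult_0_r).
        pose proof (is_RInt_const (V := C_R_NormedModule) X 0 (0, 0)) as H.
        exact (eq_ind _ (is_RInt (V := C_R_NormedModule) _ X 0) H _ E0).
  - assert (Hcs : forall th x, continuous (fun x => cos (s * x - th) * g x) x)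
      by (intros; apply integrand_cont, Hg).
    assert (Hint : is_RInt_gen (V := C_R_NormedModule)
      (fun x => (cos (s * x - PI / 2) * g x, - (cos (s * x - 0) * g x)))
      (at_point 0) (Rbar_locally p_infty) (d, - c)).
    { apply is_RInt_gen_complex.
      - apply Hcs.
      - intros x; apply (continuous_opp (fun x => cos (s * x - 0) * g x)), Hcs.
      - exact Hd.
      - apply (is_lim_ext (fun X => - RInt (fun x => cos (s * x - 0) * g x) 0 X)).
        + intros X; symmetry.
          apply (RInt_opp (fun x => cos (s * x - 0) * g x)).
          apply ex_RInt_everywhere_continuous, Hcs.
        + exact (is_lim_opp _ _ _ Hc). }
    assert (Hcos : forall y, cos (y - PI / 2) = sin y)
      by (intros y; rewrite cos_minus, cos_PI2, sin_PI2; ring).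
    refine (is_RInt_gen_ext (V := C_R_NormedModule) _ _ _ _ Hint).
    apply filter_forall; intros _ x _.
    unfold Cmult, expi; simpl; rewrite Hcos, Rminus_0_r; f_equal; ring.
  - unfold Cplus; simpl; f_equal; ring.
Qed.

Theorem mainTheorem1 :
  forall a : nat -> R,
    (forall n : nat, (1 <= n)%nat -> 0 < a n) ->
    exists f : R -> C,
      (forall x : R, continuous f x) /\
      (forall s : R, ex_fourier f s) /\
      (forall n : nat, (1 <= n)%nat ->
         exists r : R, is_fourier f (INR n) (RtoC r) /\ a n <= r).
Proof.
  intros a _.
  (* Block n has S (N n) periods, so that the value at n will be
     2^-n * PI * S (N n); as PI >= 1 and N n >= 2^n * a n, this is at least a n.
     The successor keeps the block ends strictly increasing. *)
  set (N := fun n => Z.to_nat (up (2 ^ n * a n))).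
  set (M := fix M n := match n with O => O | S k => (M k + S (N k))%nat end).
  set (t := fun k => 2 * INR (M k) * PI).
  assert (HM : forall k, (M k < M (S k))%nat) by (intros k; simpl; lia).
  assert (Hz : forall k j, (/ 2) ^ k * sin (INR k * (2 * INR (M j) * PI)) = 0).
  { intros k j.
    replace (INR k * (2 * INR (M j) * PI)) with (0 + 2 * INR (k * M j) * PI)
      by (rewrite mult_INR; ring).
    rewrite sin_period, sin_0; ring. }
  destruct (glue_blocks t (fun k x => (/ 2) ^ k * sin (INR k * x)))
    as [g [g_cont [g_neg g_block]]].
  - intros k; apply (block_ends_mono M HM).
  - intros k; apply (block_ends_unbounded M eq_refl HM).
  - intros k x.
    apply (ex_derive_continuous (fun x => (/ 2) ^ k * sin (INR k * x))).
    now auto_derive.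
  - intros k; apply Hz.
  - intros k; apply Hz.
  - assert (Hneg : forall x, x <= 0 -> g x = 0).
    { intros x Hx; apply g_neg; unfold t; simpl; lra. }
    exists (fun x => (0, - g x)); split; [|split].
    + intros x P [e He].
      apply (filter_imp (F := locally x) (fun y => ball (- g x) e (- g y))).
      * intros y Hy; apply He; split; [apply ball_center|exact Hy].
      * exact (continuous_opp g x (g_cont x) _ (locally_ball _ e)).
    + intros s.
      destruct (fourier_component_converges M g eq_refl HM g_cont g_block s 0) as [c [_ Hc]].
      destruct (fourier_component_converges M g eq_refl HM g_cont g_block s (PI / 2))
        as [d [_ Hd]].
      exists (d, - c); now apply is_fourier_of_components.
    + intros n Hn.
      pose proof (fourier_component_at_integer M g eq_refl HM g_cont g_block n 0 Hn) as Hc.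
      pose proof (fourier_component_at_integer M g eq_refl HM g_cont g_block n (PI / 2) Hn)
        as Hd.
      eexists; split.
      * pose proof (is_fourier_of_components g (INR n) _ _ g_cont Hneg Hc Hd) as H.
        rewrite sin_0 in H.
        replace (- _) with 0 in H by (unfold Rdiv; ring).
        exact H.
      * rewrite sin_PI2.
        change (M (S n)) with (M n + S (N n))%nat.
        rewrite plus_INR, S_INR.
        pose proof (le_INR_up (2 ^ n * a n)) as Ha; fold (N n) in Ha.
        pose proof PI2_1; pose proof (pos_INR (N n)).
        replace (a n) with ((/ 2) ^ n * (2 ^ n * a n))
          by (rewrite <- Rmult_assoc, <- Rpow_mult_distr, Rinv_l, pow1 by lra; ring).
        apply Rmult_le_compat_l; [apply pow_le; lra|nra].
Qed.
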